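(* Let $E$ and $F$ be nonempty convex sets in $\mathbb{R}^n$. The following assertions are equivalent. (a) Every vector $u \in \mathbb{R}^n$ is uniquely expressible as $u = y + z$, where $y$ and $z$ are orthogonal vectors from $E$ and $F$, respectively; that is, for every $u\in\mathbb{R}^n$ there is exactly one pair $(y,z)\in E\times F$ with $y\cdot z=0$ and $u=y+z$. (b) $E$ and $F$ are convex cones which are polar of each other, i.e. $E = F^\circ$ and $F = E^\circ$.
   Context: $\mathbb{R}^n$ carries the standard dot product $x\cdot y$; $x$ and $y$ are orthogonal if $x\cdot y=0$. A nonempty convex set $C$ is a convex cone if $\lambda x\in C$ whenever $\lambda\geqslant 0$ and $x\in C$ (so the origin $o$ belongs to $C$). The (negative) polar set of a nonempty set $X\subseteq\mathbb{R}^n$ is $X^\circ=\{x\in\mathbb{R}^n: x\cdot e\leqslant 0\ \ \forall\, e\in X\}$. Convex cones $C$ and $D$ are polar of each other if $C=D^\circ$ and $D=C^\circ$. For the ordered pair $(E,F)$, expressions $u=y_1+z_1$ and $u=y_2+z_2$ with $y_i\in E$, $z_i\in F$ are considered different if and only if $y_1\neq y_2$ (equivalently $z_1\neq z_2$). The sets $E$ and $F$ are not assumed to be closed. *)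

(* Defs.v *)
From mathcomp Require Import all_boot all_order all_algebra.
From mathcomp Require Import classical_sets reals convex.

Set Implicit Arguments.
Unset Strict Implicit.
Unset Printing Implicit Defensive.

Import Order.TTheory GRing.Theory Num.Theory.

Local Open Scope classical_set_scope.
Local Open Scope ring_scope.

(* The [dotmx] of spectral.v is only available over a numClosedFieldType. *)
Definition dotr (R : realType) (n : nat) (x y : 'rV[R]_n) : R :=
  \sum_(i < n) x 0 i * y 0 i.

Definition orthogonal_vec (R : realType) (n : nat) (x y : 'rV[R]_n) : Prop :=
  dotr x y = 0.

Definition convex_cone (R : realType) (n : nat) (C : set 'rV[R]_n) : Prop :=
  [/\ C !=set0, convex_set C &
      forall (l : R) (x : 'rV[R]_n), 0 <= l -> C x -> C (l *: x)].

Definition polar (R : realType) (n : nat) (X : set 'rV[R]_n) : set 'rV[R]_n :=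
  [set x | forall e, X e -> dotr x e <= 0].

Definition mutually_polar (R : realType) (n : nat) (C D : set 'rV[R]_n) : Prop :=
  C = polar D /\ D = polar C.

(* Decompositions are pairs in E x F, so that distinct pairs with the same sum
   count as different expressions of u. *)
Definition orthogonal_decomposition (R : realType) (n : nat)
    (E F : set 'rV[R]_n) (u : 'rV[R]_n) (yz : 'rV[R]_n * 'rV[R]_n) : Prop :=
  [/\ E yz.1, F yz.2, orthogonal_vec yz.1 yz.2 & u = yz.1 + yz.2].

(* Main.v *)
Require Import Defs.
From mathcomp Require Import all_boot all_order all_algebra.
From mathcomp Require Import classical_sets reals convex.
From mathcomp Require Import boolp topology normedtype derive interval_inference.
From mathcomp Require Import ring lra.

Set Implicit Arguments.
Unset Strict Implicit.
Unset Printing Implicit Defensive.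

Import Order.TTheory GRing.Theory Num.Theory.
Import numFieldNormedType.Exports.

Local Open Scope classical_set_scope.
Local Open Scope ring_scope.

(** (b) => (a) is Moreau's decomposition. For (a) => (b), first replace [E] and
    [F] by the cones [C] and [D] they generate: both contain [0], so by scaling
    down, decompositions along [C] and [D] are still unique. Existence alone
    gives [polar C `<=` D] and [polar D `<=` C]; everything else reduces to
    [C `<=` polar D].

    Take [u] in the relative interior of [C] and project it on the closure of
    [D]: [u = p + q] with [p] in [polar D `<=` C] and [p] orthogonal to [q].
    Since [D] contains the orthogonal complement of the span of [C], [q] is
    approached by points [d] of [D] with [d - q] in that span, so that
    [p + d] is in [C], while [dotr p d <= 0]. If [q] were nonzero,
    [dotr (p + d) d] would be positive, and sliding [p + d] towards [p] along
    [d] would give a second orthogonal decomposition of the vector [p + d],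
    next to [(p + d) + 0]. Hence [q = 0] and [u] is in [polar D]. *)

(** * The dot product and its continuity *)

Section DotProduct.
Context {R : realType} {n : nat}.
Implicit Types (x y z : 'rV[R]_n) (a : R).

Lemma dotrC x y : dotr x y = dotr y x.
Proof. by apply: eq_bigr => i _; rewrite mulrC. Qed.

Lemma dotrDl x y z : dotr (x + y) z = dotr x z + dotr y z.
Proof.
by rewrite /dotr -big_split; apply: eq_bigr => i _; rewrite mxE mulrDl.
Qed.

Lemma dotrZl a x y : dotr (a *: x) y = a * dotr x y.
Proof. by rewrite /dotr mulr_sumr; apply: eq_bigr => i _; rewrite mxE mulrA. Qed.

Lemma dotrNl x y : dotr (- x) y = - dotr x y.
Proof. by rewrite -scaleN1r dotrZl mulN1r. Qed.

Lemma dotrDr x y z : dotr x (y + z) = dotr x y + dotr x z.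
Proof. by rewrite dotrC dotrDl !(dotrC x). Qed.

Lemma dotrZr a x y : dotr x (a *: y) = a * dotr x y.
Proof. by rewrite dotrC dotrZl (dotrC x). Qed.

Lemma dotrNr x y : dotr x (- y) = - dotr x y.
Proof. by rewrite dotrC dotrNl (dotrC x). Qed.

Definition dotrE := (dotrDl, dotrDr, dotrNl, dotrNr, dotrZl, dotrZr).

Lemma dot0r x : dotr 0 x = 0.
Proof. by rewrite -(scale0r x) dotrZl mul0r. Qed.

Lemma dotr0 x : dotr x 0 = 0.
Proof. by rewrite dotrC dot0r. Qed.

Lemma dotrr_ge0 x : 0 <= dotr x x.
Proof. by apply: sumr_ge0 => i _; rewrite -expr2 sqr_ge0. Qed.

Lemma dotrr_le0 x : dotr x x <= 0 -> x = 0.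
Proof.
move=> xx; have /eqP : dotr x x = 0 by apply/eqP; rewrite eq_le xx dotrr_ge0.
rewrite psumr_eq0 => [/allP h|i _]; last by rewrite -expr2 sqr_ge0.
apply/rowP => i; rewrite mxE; apply/eqP.
by have := h i (mem_index_enum i); rewrite /= mulf_eq0 orbb.
Qed.

Lemma dotrr_gt0 x : x <> 0 -> 0 < dotr x x.
Proof. by move=> x0; rewrite ltNge; apply/negP => /dotrr_le0. Qed.

Lemma dotr_mulmx x y : dotr x y = (x *m y^T) 0 0.
Proof. by rewrite mxE; apply: eq_bigr => i _; rewrite mxE. Qed.

Lemma coord_le_norm m (x : 'rV[R]_m) i : `|x 0 i| <= `|x|.
Proof.
rewrite [leRHS]/Num.norm /= mx_normrE; apply/bigmax_geP; right => /=.
by exists (0, i).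
Qed.

(** [|x|] is the sup norm, not the Euclidean one; this bound stands in for Cauchy-Schwarz when
    nearness in norm is turned into an estimate on [dotr]. *)
Lemma dotr_bound y : exists2 K, 0 <= K & forall x, `|dotr x y| <= K * `|x|.
Proof.
exists (\sum_i `|y 0 i|) => [|x]; first exact: sumr_ge0.
rewrite mulr_suml (le_trans (ler_norm_sum _ _ _))// ler_sum// => i _.
by rewrite normrM mulrC ler_wpM2l// coord_le_norm.
Qed.

Lemma continuous_sum (T : topologicalType) I (s : seq I) (f : I -> T -> R) :
  (forall i, continuous (f i)) -> continuous (fun t => \sum_(i <- s) f i t).
Proof.
move=> fc; elim: s => [|i s IH] t.
  by under eq_fun do rewrite big_nil; exact: cst_continuous.
under eq_fun do rewrite big_cons.
by apply: (continuousD (f := f i)); [exact: fc|exact: IH].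
Qed.

Lemma dotrr_continuous (u : 'rV[R]_n) :
  continuous (fun x : 'rV[R]_n => dotr (u - x) (u - x)).
Proof.
apply: continuous_sum => i x.
have h : {for x, continuous (fun z : 'rV[R]_n => (u - z) 0 i)}.
  have -> : (fun z : 'rV[R]_n => (u - z) 0 i) = fun z => u 0 i - z 0 i.
    by apply/funext => z; rewrite !mxE.
  apply: (continuousB (f := fun=> u 0 i)); first exact: cst_continuous.
  exact: coord_continuous.
exact: (continuousM h h).
Qed.

End DotProduct.

Lemma mulmx_bound (R : realType) m n (P : 'M[R]_(n, m)) :
  exists2 K, 0 <= K & forall (x : 'rV_n) i, `|(x *m P) 0 i| <= K * `|x|.
Proof.
exists (\sum_i \sum_j `|P j i|) => [|x i].
  by apply: sumr_ge0 => i _; apply: sumr_ge0.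
rewrite mxE (bigD1 i)//= mulrDl -[leLHS]addr0 lerD//; last first.
  by apply: mulr_ge0 => //; apply: sumr_ge0 => k _; apply: sumr_ge0.
rewrite mulr_suml (le_trans (ler_norm_sum _ _ _))// ler_sum// => j _.
by rewrite normrM mulrC ler_wpM2l// coord_le_norm.
Qed.

Lemma le0_of_small (R : realFieldType) (a b : R) :
  (forall t, 0 < t -> t <= 1 -> a + t * b <= 0) -> a <= 0.
Proof.
move=> h; rewrite leNgt; apply/negP => a0.
have c0 : 0 < a + `|b| by rewrite ltr_wpDr.
(* At half of this value the perturbation has size at most [a / 2], so the sum stays positive. *)
have t0 : 0 < a / (a + `|b|) by rewrite divr_gt0.
have E : a / (a + `|b|) * (a + `|b|) = a by rewrite divfK// gt_eqF.
have b0 := normr_ge0 b; have bb := ler_norm (- b); rewrite normrN in bb.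
move: t0 E; set t := a / _ => t0 E.
have t1 : t <= 1 by nra.
have := h (t / 2); have -> : 0 < t / 2 by lra.
have -> : t / 2 <= 1 by lra.
move=> /(_ isT isT); nra.
Qed.

(** * Convex cones and polars *)

Section ConvexCone.
Context {R : realType} {n : nat}.
Implicit Types (x y : 'rV[R]_n) (C D E X : set 'rV[R]_n).

Lemma convex_setP E : convex_set E <->
  forall x y t, 0 <= t -> t <= 1 -> E x -> E y -> E (t *: x + (1 - t) *: y).
Proof.
split=> [cE x y t t0 t1 Ex Ey|cE x y l].
  have := cE x y (Itv01 t0 t1).
  by rewrite !inE; apply.
by rewrite !inE => Ex Ey; apply: cE.
Qed.

Lemma convex_coneZ C x l : convex_cone C -> 0 <= l -> C x -> C (l *: x).
Proof. by case=> _ _; apply. Qed.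

Lemma convex_cone0 C : convex_cone C -> C 0.
Proof. by case=> -[x Cx] _ CZ; rewrite -(scale0r x); exact: CZ. Qed.

Lemma convex_coneD C x y : convex_cone C -> C x -> C y -> C (x + y).
Proof.
case=> _ /convex_setP cC CZ Cx Cy.
have -> : x + y = 2 *: (2^-1 *: x + (1 - 2^-1) *: y).
  by rewrite scalerDr !scalerA mulrBr mulr1 divff// addrK !scale1r.
by apply: CZ => //; apply: cC => //; lra.
Qed.

Lemma convex_cone_sum C m (F : 'I_m -> 'rV[R]_n) : convex_cone C ->
  (forall i, C (F i)) -> C (\sum_i F i).
Proof.
move=> cC CF; apply: big_ind => [|x y|//]; first exact: convex_cone0.
exact: convex_coneD.
Qed.

Lemma convex_coneP C : C 0 -> (forall x y, C x -> C y -> C (x + y)) ->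
  (forall l x, 0 <= l -> C x -> C (l *: x)) -> convex_cone C.
Proof.
move=> C0 CD CZ; split=> //; first by exists 0.
by apply/convex_setP => x y t t0 t1 Cx Cy; apply: CD; apply: CZ; rewrite ?subr_ge0.
Qed.

Lemma polar_convex_cone X : convex_cone (polar X).
Proof.
apply: convex_coneP => [e _|x y Px Py e Xe|l x l0 Px e Xe]; first by rewrite dot0r.
  by rewrite dotrDl -[leRHS]addr0 lerD ?Px ?Py.
by rewrite dotrZl mulr_ge0_le0// Px.
Qed.

(** * Nearest points in the closure of a cone *)

Lemma closure_stable (g : 'rV[R]_n -> 'rV[R]_n) C x : continuous g ->
  (forall y, C y -> C (g y)) -> closure C x -> closure C (g x).
Proof.
move=> gc Cg Cx B /gc /Cx[y [Cy By]].
by exists (g y); split => //; exact: Cg.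
Qed.

Lemma closure_approx C x d : closure C x -> 0 < d ->
  exists2 y, C y & `|y - x| < d.
Proof.
move=> Cx d0; have [y [Cy xy]] := Cx _ (nbhsx_ballx x d d0).
by exists y => //; move: xy; rewrite -ball_normE /= distrC.
Qed.

Lemma projection_closure C u : C !=set0 ->
  exists2 q, closure C q &
    forall x, closure C x -> dotr (u - q) (u - q) <= dotr (u - x) (u - x).
Proof.
case=> c Cc; set f := fun x => dotr (u - x) (u - x).
have fc : continuous f by exact: dotrr_continuous.
(* Only points at least as close to [u] as [c] compete, and they form a compact set. *)
set A := closure C `&` f @^-1` [set r | r <= f c].
have Ac : A c by split; [exact: subset_closure|rewrite /= lexx].
have cA : compact A.
  apply: bounded_closed_compact.
    exists (`|u| + 1 + f c); split; first exact: num_real.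
    move=> M; set M0 := _ + _ + _ => M0M x [_ /= fx].
    apply: le_trans (ltW M0M).
    have fc0 : 0 <= f c by exact: dotrr_ge0.
    suff h : `|u - x| <= 1 + f c.
      rewrite -(subKr u x) (le_trans (ler_normB _ _))// /M0 -addrA lerD2l.
      exact: h.
    have M1 : 0 <= 1 + f c by lra.
    rewrite [leLHS]/Num.norm /= mx_normrE; apply/bigmax_leP; split=> // -[i j] _ /=.
    (* Each coordinate satisfies [a ^+ 2 <= f c], hence is at most [1 + f c] in absolute value,
       without square roots. *)
    rewrite ord1; set a := (u - x) 0 j.
    have : a ^+ 2 <= f x.
      rewrite /f /dotr (bigD1 j)//= -/a expr2 lerDl.
      by apply: sumr_ge0 => k _; rewrite -expr2 sqr_ge0.
    rewrite -real_normK ?num_real// => a2; have := normr_ge0 a; nra.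
  apply: closedI; first exact: closed_closure.
  by apply: preimage_closed => [x _|]; [exact: fc|exact: closed_le].
have [q] := compact_EVT_min (ex_intro _ c Ac) cA (continuous_subspaceT fc).
rewrite inE => -[Cq fq] qmin; exists q => // x Cx.
have [fx|/ltW fx] := leP (f x) (f c); last exact: le_trans fx.
by apply: qmin; rewrite inE.
Qed.

Lemma moreau_closure C u : convex_cone C ->
  exists q, [/\ closure C q, polar C (u - q) & dotr (u - q) q = 0].
Proof.
move=> cC; have [q Cq qmin] := projection_closure u (ex_intro _ 0 (convex_cone0 cC)).
move pE : (u - q) qmin => p qmin.
(* First-order optimality: expand the squared length of [p - t *: v], divide by [t], and let [t]
   tend to 0. *)
have dir v : (forall t, 0 < t -> t <= 1 -> closure C (q + t *: v)) ->
    dotr p v <= 0.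
  move=> Cv; suff : 2 * dotr p v <= 0 by lra.
  apply: (@le0_of_small _ _ (- dotr v v)) => t t0 t1.
  have := qmin _ (Cv t t0 t1); rewrite opprD addrA pE !dotrE (dotrC v p).
  by move=> h; rewrite -(pmulr_rle0 _ t0); lra.
have Cq' t : 0 < t -> closure C (t *: q).
  move=> t0; apply: (closure_stable (g := fun x => t *: x)) Cq.
    exact: scaler_continuous.
  by move=> y; apply: convex_coneZ => //; exact: ltW.
exists q; rewrite pE; split=> //.
  move=> d Cd; apply: dir => t t0 t1.
  apply: (closure_stable (g := fun x => x + t *: d)) Cq.
    move=> x; apply: (continuousD (f := id)); first exact: cvg_id.
    exact: cst_continuous.
  by move=> y Cy; apply: convex_coneD => //; apply: convex_coneZ => //; exact: ltW.
apply/eqP; rewrite eq_le; apply/andP; split.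
  by apply: dir => t t0 _; rewrite -{1}(scale1r q) -scalerDl; apply: Cq'; lra.
suff : dotr p (- q) <= 0 by rewrite dotrE; lra.
(* Halving keeps [q - t *: (2^-1 *: q)] a positive multiple of [q] up to [t = 1]. *)
suff : dotr p (- (2^-1 *: q)) <= 0 by rewrite !dotrE; lra.
apply: dir => t t0 t1.
by rewrite scalerN -{1}(scale1r q) scalerA -scalerBl; apply: Cq'; lra.
Qed.

(** * Spans of cones and their orthogonal complements *)

Lemma exists_spanning_rows C : convex_cone C ->
  exists m (A : 'M[R]_(m, n)),
    (forall i, C (row i A)) /\ (forall x, C x -> (x <= A)%MS).
Proof.
move=> cC.
(* Take a matrix of maximal rank among those with rows in [C]: appending a further [x] of [C] cannot
   raise the rank, so [x] is in the row space. *)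
pose P k := `[< exists m (A : 'M[R]_(m, n)),
                  (forall i, C (row i A)) /\ \rank A = k >].
have exP : exists k, P k.
  by exists (\rank (0 : 'M[R]_(0, n))); apply/asboolP; exists 0%N, 0; split=> // -[].
have ubP k : P k -> (k <= n)%N by move=> /asboolP[m [A [_ <-]]]; exact: rank_leq_col.
case: (ex_maxnP exP ubP) => k /asboolP[m [A [CA rA]]] kmax.
exists m, A; split=> // x Cx.
have Ac : (A <= col_mx A x)%MS by rewrite -addsmxE addsmxSl.
suff : (col_mx A x <= A)%MS by rewrite -addsmxE; apply: submx_trans; exact: addsmxSr.
rewrite -(mxrank_leqif_sup Ac) eqn_leq mxrankS//= rA; apply: kmax.
apply/asboolP; exists (m + 1)%N, (col_mx A x); split=> // i.
case: (split_ordP i) => j ->; first by rewrite rowKu.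
by rewrite rowKd (_ : row j x = x)//; apply/rowP => l; rewrite mxE ord1.
Qed.

(** The row space of [A] and the kernel of [A^T] are orthogonal complements. The bound on [c]
    ensures that a small [v] has small coefficients on the rows. *)
Lemma row_orth_decomposition m (A : 'M[R]_(m, n)) : exists2 K, 0 <= K &
  forall v : 'rV[R]_n, exists c w,
    [/\ v = c *m A + w, w *m A^T = 0 & forall i, `|c 0 i| <= K * `|v|].
Proof.
pose N := kermx A^T.
have full : row_full (col_mx A N).
  rewrite -col_leq_rank -addsmxE.
  have cap0 : (A :&: N)%MS = 0.
    apply/eqP; rewrite -submx0; apply/row_subP => i; rewrite submx0.
    have : (row i (A :&: N)%MS <= A :&: N)%MS by exact: row_sub.
    rewrite sub_capmx => /andP[/submxP[a ra] /sub_kermxP raT].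
    apply/eqP; apply: dotrr_le0; rewrite dotr_mulmx {2}ra trmx_mul mulmxA raT.
    by rewrite mul0mx mxE.
  have := mxrank_sum_cap A N.
  by rewrite cap0 mxrank0 addn0 mxrank_ker mxrank_tr subnKC ?rank_leq_col// => ->.
have [K K0 PK] := mulmx_bound (pinvmx (col_mx A N)).
exists K => // v; pose a := v *m pinvmx (col_mx A N).
exists (lsubmx a), (rsubmx a *m N); split.
- by rewrite -mul_row_col hsubmxK mulmxKpV// submx_full.
- by rewrite -mulmxA mulmx_ker mulmx0.
- by move=> i; rewrite mxE; exact: PK.
Qed.

(** * Cones with unique orthogonal decompositions *)

Section UniqueDecomposition.
Variables C D : set 'rV[R]_n.
Hypotheses (cC : convex_cone C) (cD : convex_cone D).
Hypothesis decomp : forall u,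
  exists y z, [/\ C y, D z, dotr y z = 0 & u = y + z].
Hypothesis uniq : forall y1 z1 y2 z2, C y1 -> D z1 -> dotr y1 z1 = 0 ->
  C y2 -> D z2 -> dotr y2 z2 = 0 -> y1 + z1 = y2 + z2 -> y1 = y2.

(** Pairing [v = y + z] with [y] leaves [dotr y y], which must then be nonpositive. *)
Lemma polar_subl : polar C `<=` D.
Proof.
move=> v Cv; have [y [z [Cy Dz yz vE]]] := decomp v.
have := Cv y Cy; rewrite vE dotrDl (dotrC z) yz addr0 => /dotrr_le0 y0.
by rewrite y0 add0r.
Qed.

Lemma polar_subr : polar D `<=` C.
Proof.
move=> v Dv; have [y [z [Cy Dz yz vE]]] := decomp v.
have := Dv z Dz; rewrite vE dotrDl yz add0r => /dotrr_le0 z0.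
by rewrite z0 addr0.
Qed.

(* Otherwise [(p + d - t *: d) + t *: d], with [t] the coefficient of the
   projection of [p + d] on [d], decomposes [p + d] besides [(p + d) + 0]. *)
Lemma add_not_acute p d : C p -> D d -> C (p + d) -> dotr p d <= 0 ->
  dotr (p + d) d <= 0.
Proof.
move=> Cp Dd Cpd pd; rewrite leNgt; apply/negP => h.
have d0 : 0 < dotr d d by move: h; rewrite dotrDl; lra.
pose t := dotr (p + d) d / dotr d d.
have tE : t * dotr d d = dotr (p + d) d by rewrite divfK// gt_eqF.
have t0 : 0 < t by rewrite divr_gt0.
(* Here [dotr p d <= 0] enters; it makes [p + d - t *: d] a convex combination of [p + d] and
   [p]. *)
have t1 : t <= 1 by move: tE; rewrite dotrDl; nra.
have Cpdt : C (p + d - t *: d).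
  have -> : p + d - t *: d = (1 - t) *: (p + d) + t *: p.
    by apply/rowP => i; rewrite !mxE; ring.
  apply: convex_coneD => //; apply: convex_coneZ => //; first by rewrite subr_ge0.
  exact: ltW.
have := uniq Cpdt (convex_coneZ cD (ltW t0) Dd) _ Cpd (convex_cone0 cD) (dotr0 _).
have -> : dotr (p + d - t *: d) (t *: d) = 0.
  by rewrite dotrDl dotrNl !dotrZr dotrZl tE subrr.
rewrite subrK addr0 => /(_ erefl erefl) /(congr1 (fun x => dotr x d)).
rewrite dotrDl dotrNl dotrZl tE; lra.
Qed.

Lemma unique_decomposition_polar x f : C x -> D f -> dotr x f <= 0.
Proof.
move=> Cx Df.
have [m [A [CA A_span]]] := exists_spanning_rows cC.
(* [r], hence each [x + e *: r], is in the relative interior of [C]. *)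
pose r := \sum_i row i A.
have Cr : C r by exact: convex_cone_sum.
have [K K0 AK] := row_orth_decomposition A.
apply: (@le0_of_small _ _ (dotr r f)) => e e0 _.
suff : polar D (x + e *: r) by move=> /(_ f Df); rewrite dotrDl dotrZl.
move uE : (x + e *: r) => u.
have Cu : C u.
  rewrite -uE; apply: convex_coneD => //.
  exact: convex_coneZ (ltW e0) Cr.
have [q [Dq]] := moreau_closure u cD.
move pE : (u - q) => p Dp pq.
have [q0|/dotrr_gt0 q0] := pselect (q = 0); first by rewrite -[u]subr0 -q0 pE.
have Cp := polar_subr Dp.
(* With [s = c *m A] below, [dotr (q + s) (p + q + s)] expands to [dotr q q + dotr (p + 2 *: q) s +
   dotr s s]. *)
have [L L0 wL] := dotr_bound (p + 2 *: q).
(* The first bound keeps every [e + c 0 i] nonnegative; the second makes the term linear in [s]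
   smaller than [dotr q q]. *)
pose d := Num.min (e / (K + 1)) (dotr q q / (L + 1)).
have K1 : 0 < K + 1 by lra.
have L1 : 0 < L + 1 by lra.
have d0 : 0 < d by rewrite lt_min !divr_gt0.
have [y Dy yd] := closure_approx Dq d0.
have [c [w [vE wA cv]]] := AK (y - q).
have wC z : C z -> dotr w z = 0.
  move=> /A_span/submxP[a ->].
  by rewrite dotr_mulmx trmx_mul mulmxA wA mul0mx mxE.
(* Subtracting [w] from [y] stays in [D] and leaves a difference from [q] in the span of [C]. *)
have Dw : D (- w) by apply: polar_subl => z Cz; rewrite dotrNl wC// oppr0.
have sE : p + (y - w) = u + c *m A.
  by rewrite -pE -addrA; congr (_ + _); rewrite addrA [- q + y]addrC vE addrK.
have ce i : 0 <= e + c 0 i.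
  have := cv i; have : `|y - q| < e / (K + 1) by move: yd; rewrite lt_min => /andP[].
  rewrite ltr_pdivlMr// => h1 h2; have := ler_norm (- c 0 i); rewrite normrN.
  have := normr_ge0 (y - q); nra.
have Cs : C (u + c *m A).
  have -> : u + c *m A = x + \sum_i (e + c 0 i) *: row i A.
    rewrite -uE -addrA mulmx_sum_row scaler_sumr -big_split; congr (_ + _).
    by apply: eq_bigr => i _; rewrite scalerDl.
  apply: convex_coneD => //; apply: convex_cone_sum => // i.
  exact: convex_coneZ.
have Dyw : D (y - w) by exact: convex_coneD.
have := add_not_acute Cp Dyw _ (Dp _ Dyw); rewrite sE => /(_ Cs).
have -> : y - w = q + c *m A.
  by apply/eqP; rewrite subr_eq -addrA -vE addrCA subrr addr0.
have wp : dotr w p = 0 by exact: wC.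
have wq : dotr w q = 0.
  by have := wC u Cu; rewrite -[u](subrK q) pE dotrDr wp add0r.
(* As [w] is orthogonal to [p] and [q], the linear term is controlled by the norm of [y - q]. *)
have sL : dotr (p + 2 *: q) (c *m A) = dotr (y - q) (p + 2 *: q).
  by rewrite [RHS]dotrC vE dotrDr [dotr _ w]dotrC [dotr w _]dotrDr dotrZr wp wq mulr0 !addr0.
have := wL (y - q); rewrite -sL.
have : `|y - q| < dotr q q / (L + 1) by move: yd; rewrite lt_min => /andP[].
rewrite ltr_pdivlMr// => yq.
have := ler_norm (- dotr (p + 2 *: q) (c *m A)); rewrite normrN.
have := dotrr_ge0 (c *m A); have := normr_ge0 (y - q).
move: (c *m A) => s; rewrite -[u](subrK q) pE !dotrE pq (dotrC s q); nra.
Qed.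

End UniqueDecomposition.

(** * Cones generated by convex sets *)

Definition conic_hull E : set 'rV[R]_n :=
  [set x | exists l e, [/\ 0 <= l, E e & x = l *: e]].

Lemma convex_cone_conic_hull E : E !=set0 -> convex_set E ->
  convex_cone (conic_hull E).
Proof.
move=> [e0 Ee0] /convex_setP cE; apply: convex_coneP.
- by exists 0, e0; rewrite scale0r.
- move=> _ _ [l [e [l0 Ee ->]]] [k [f [k0 Ef ->]]].
  have [lk|lk] := eqVneq (l + k) 0.
    have -> : l = 0 by lra.
    have -> : k = 0 by lra.
    by exists 0, e; rewrite !scale0r addr0.
  have lk0 : 0 < l + k by rewrite lt_neqAle eq_sym lk addr_ge0.
  exists (l + k), (l / (l + k) *: e + (1 - l / (l + k)) *: f); split=> //.
  + exact: ltW.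
  + by apply: cE => //; rewrite ?divr_ge0 ?(ltW lk0)// ler_pdivrMr// mul1r lerDl.
  + rewrite scalerDr !scalerA mulrBr mulr1 mulrC divfK//.
    by rewrite (addrC l) addrK.
- move=> l _ l0 [k [e [k0 Ee ->]]]; exists (l * k), e.
  by rewrite mulr_ge0// scalerA.
Qed.

(** For [s] at most [(l + 1)^-1], [s *: x] lies on the segment from 0 to [e]; adding 1 covers
    [l = 0]. *)
Lemma conic_hull_shrink E x : convex_set E -> E 0 -> conic_hull E x ->
  exists2 t, 0 < t & forall s, 0 <= s -> s <= t -> E (s *: x).
Proof.
move=> /convex_setP cE E0 [l [e [l0 Ee ->]]]; exists (l + 1)^-1.
  by rewrite invr_gt0; lra.
move=> s s0 st; rewrite scalerA.
have sl1 : s * l <= 1.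
  have : s * (l + 1) <= 1 by rewrite -ler_pdivlMr ?div1r//; lra.
  nra.
by have := cE e 0 (s * l) (mulr_ge0 s0 l0) sl1 Ee E0; rewrite scaler0 addr0.
Qed.

Lemma subset_conic_hull E : E `<=` conic_hull E.
Proof. by move=> e Ee; exists 1, e; rewrite scale1r. Qed.

(** * Decomposition along mutually polar cones *)

Lemma mutually_polar_unique C D u yz : convex_cone C -> mutually_polar C D ->
  orthogonal_decomposition C D u yz -> forall yz',
  orthogonal_decomposition C D u yz' -> yz = yz'.
Proof.
case: yz => y z cC [CE DE] [/= Cy Dz yz uE] [y' z'] [/= Cy' Dz' yz' uE'].
(* The square of [y - y'] is its product with [z' - z], in which only the nonpositive [dotr y z']
   and [dotr y' z] survive. *)
have : y - y' = 0.
  apply: dotrr_le0.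
  have zz : y - y' = z' - z.
    by apply/eqP; rewrite subr_eq addrAC eq_sym subr_eq addrC -uE' uE.
  rewrite {2}zz !dotrE yz yz'.
  have : dotr y z' <= 0 by rewrite CE in Cy; exact: Cy.
  have : dotr y' z <= 0 by rewrite CE in Cy'; exact: Cy'.
  lra.
move/eqP; rewrite subr_eq0 => /eqP yy; congr (_, _) => //.
by move: uE'; rewrite uE yy => /addrI.
Qed.

Lemma mutually_polar_decomposition C D u : convex_cone D -> mutually_polar C D ->
  exists yz, orthogonal_decomposition C D u yz.
Proof.
move=> cD [CE DE]; have [q [Dq pD pq]] := moreau_closure u cD.
exists (u - q, q); split=> //=; rewrite ?subrK ?CE// DE => e Ce.
(* [q] is only known to be in the closure of [D]; a polar is closed, as approximation by points of
   [D] shows. *)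
rewrite dotrC; have [K K0 eK] := dotr_bound e.
apply: (@le0_of_small _ _ (- K)) => t t0 _.
have [d Dd dq] := closure_approx Dq t0.
have : dotr d e <= 0 by move: Dd; rewrite DE; exact.
have := eK (d - q); have := ler_norm (- dotr (d - q) e); rewrite normrN.
rewrite (dotrC e) !dotrE; nra.
Qed.

(** * From convex sets to the cones they generate *)

Section UniqueDecompositionConvex.
Variables E F : set 'rV[R]_n.
Hypotheses (E0 : E !=set0) (F0 : F !=set0).
Hypotheses (cE : convex_set E) (cF : convex_set F).
Hypothesis decomp : forall u,
  exists! yz, orthogonal_decomposition E F u yz.

(** Decomposing 0 gives [y = - z], and orthogonality then forces both to vanish. *)
Lemma decomposition_mem0 : E 0 /\ F 0.
Proof.
have [[y z] [[/= Ey Fz yz /eqP]]] := decomp 0.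
rewrite eq_sym addr_eq0 => /eqP yE _.
have z0 : z = 0 by apply: dotrr_le0; move: yz; rewrite yE /orthogonal_vec dotrNl; lra.
by move: Ey Fz; rewrite yE z0 oppr0.
Qed.

Lemma decomposition_inj y1 z1 y2 z2 : E y1 -> F z1 -> dotr y1 z1 = 0 ->
  E y2 -> F z2 -> dotr y2 z2 = 0 -> y1 + z1 = y2 + z2 -> y1 = y2.
Proof.
move=> Ey1 Fz1 yz1 Ey2 Fz2 yz2 eq12; have [yz [_ un]] := decomp (y1 + z1).
have : (y1, z1) = (y2, z2).
  by rewrite -(un (y1, z1))// -(un (y2, z2)).
by case.
Qed.

Lemma decomposition_polar x f : E x -> F f -> dotr x f <= 0.
Proof.
move=> Ex Ff; have [Eo Fo] := decomposition_mem0.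
apply: (unique_decomposition_polar (C := conic_hull E) (D := conic_hull F)).
- exact: convex_cone_conic_hull.
- exact: convex_cone_conic_hull.
- move=> u; have [[y z] [[/= Ey Fz yz uE] _]] := decomp u.
  by exists y, z; split=> //; exact: subset_conic_hull.
- move=> y1 z1 y2 z2 Ey1 Fz1 yz1 Ey2 Fz2 yz2 eq12.
  have [a1 a10 Ea1] := conic_hull_shrink cE Eo Ey1.
  have [b1 b10 Fb1] := conic_hull_shrink cF Fo Fz1.
  have [a2 a20 Ea2] := conic_hull_shrink cE Eo Ey2.
  have [b2 b20 Fb2] := conic_hull_shrink cF Fo Fz2.
  (* A common scale bringing both decompositions back into [E] and [F], where uniqueness is
     assumed. *)
  pose t := Num.min (Num.min a1 b1) (Num.min a2 b2).
  have t0 : 0 < t by rewrite !lt_min a10 b10 a20 b20.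
  have [[ta1 tb1] [ta2 tb2]] : (t <= a1 /\ t <= b1) /\ (t <= a2 /\ t <= b2).
    by rewrite !ge_min !lexx !orbT.
  have /(scalerI (lt0r_neq0 t0)) // : t *: y1 = t *: y2.
  apply: (decomposition_inj (z1 := t *: z1) (z2 := t *: z2)).
  + exact: Ea1 (ltW t0) _.
  + exact: Fb1 (ltW t0) _.
  + by rewrite !dotrE yz1 !mulr0.
  + exact: Ea2 (ltW t0) _.
  + exact: Fb2 (ltW t0) _.
  + by rewrite !dotrE yz2 !mulr0.
  + by rewrite -!scalerDr eq12.
- exact: subset_conic_hull.
- exact: subset_conic_hull.
Qed.

Lemma decomposition_polarE : E = polar F.
Proof.
apply/seteqP; split=> [x Ex f Ff|x Fx]; first exact: decomposition_polar.
have [[y z] [[/= Ey Fz yz xE] _]] := decomp x.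
have := Fx z Fz; rewrite xE dotrDl yz add0r => /dotrr_le0 z0.
by rewrite z0 addr0.
Qed.

End UniqueDecompositionConvex.

Lemma orthogonal_decomposition_sym E F u y z :
  orthogonal_decomposition E F u (y, z) -> orthogonal_decomposition F E u (z, y).
Proof.
by move=> [/= Ey Fz yz uE]; split=> //=; rewrite 1?addrC// /orthogonal_vec dotrC.
Qed.

End ConvexCone.

Theorem theorem1p4 (R : realType) (n : nat) (E F : set 'rV[R]_n)
  (E0 : E !=set0) (F0 : F !=set0)
  (cE : convex_set E) (cF : convex_set F) :
  (forall u : 'rV[R]_n,
     exists! yz : 'rV[R]_n * 'rV[R]_n, orthogonal_decomposition E F u yz)
  <->
  [/\ convex_cone E, convex_cone F & mutually_polar E F].
Proof.
split=> [decomp|[coneE coneF EF] u].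
  have EF : E = polar F by exact: decomposition_polarE.
  have FE : F = polar E.
    (* The hypothesis is symmetric: swapping the components exchanges [E] and [F]. *)
    apply: decomposition_polarE => // u; have [[y z] [yz un]] := decomp u.
    exists (z, y); split; first exact: orthogonal_decomposition_sym.
    by move=> [z' y'] /orthogonal_decomposition_sym/un[-> ->].
  by split; [rewrite EF|rewrite FE|split]; try exact: polar_convex_cone.
have [yz yzP] := mutually_polar_decomposition u coneF EF.
by exists yz; split=> // yz'; exact: mutually_polar_unique.
Qed.
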